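(* Let $R=k[x_0,\ldots,x_n]$ be a polynomial ring over a field $k$ of any characteristic, let $1\le c<s$ be integers, and let $\mathcal F=\{F_1,\ldots,F_s\}$ be a set of $s$ forms in $R$ such that any $c+1$ of them form a regular sequence. Let $I_{c,\mathcal F}=\bigcap_{1\le j_1<\cdots<j_c\le s}(F_{j_1},\ldots,F_{j_c})$. For any $m\ge 1$, a minimal generating set of $I_{c,\mathcal F}^{(m)}/I_{c,\mathcal F}^m$ as an $R$-module is given by (the images of the elements of) $$\mathbf G_{c,(m)}'=\{M\in \mathbf G_{c,(m)} \mid |\mathrm{supp}(M)|\ge s+2-c\}.$$
   Context: For a homogeneous ideal $I\subseteq R$ and $m\ge 1$, the symbolic power is $I^{(m)}=\bigcap_{P\in \mathrm{Ass}(R/I)}(I^mR_P\cap R)$. A monomial in $\mathcal F$ is a product (possibly with repetition) of elements of $\mathcal F$. Under the stated hypothesis on $\mathcal F$, every monomial $M$ in $\mathcal F$ is a product of elements of $\mathcal F$ in only one way up to order; $\mathrm{supp}(M)\subseteq\mathcal F$ is the set of elements occurring in it, and $M$ is squarefree if it is a product of distinct elements of $\mathcal F$. Every monomial $M$ has a unique normal form $M=M^{(1)}\cdots M^{(t)}$, where the $M^{(j)}$ are squarefree monomials in $\mathcal F$ with $\emptyset\ne\mathrm{supp}(M^{(i+1)})\subseteq\mathrm{supp}(M^{(i)})$ for all $1\le i\le t-1$. The symbolic degree of $M$ is $\mathrm{Sdeg}_c(M)=\sum_{i=1}^t\max\{0,\,c-s+|\mathrm{supp}(M^{(i)})|\}$.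 The set $\mathbf G_{c,(m)}$ consists of all monomials $M$ in $\mathcal F$ with $\mathrm{Sdeg}_c(M)=m$ and $|\mathrm{supp}(M^{(j)})|\ge s+1-c$ for every $M^{(j)}$ in the normal form of $M$. *)

(* Defs.v *)
From HB Require Import structures.
From mathcomp Require Import all_boot all_order all_algebra.
From mathcomp Require Export mpoly.

Set Implicit Arguments.
Unset Strict Implicit.
Unset Printing Implicit Defensive.

Import GRing.Theory.
Local Open Scope ring_scope.

(* Ideals are [Prop]-valued predicates: the ideal predicates of MathComp's
   ring_quotient are boolean, and membership in the ideals considered here
   is not given by a boolean test. *)

Section Ideals.
Variable R : comNzRingType.
Implicit Types (I J K S T P : R -> Prop) (x y : R).

Definition ideal_gen S x : Prop :=
  exists (m : nat) (a g : 'I_m -> R),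
    (forall i, S (g i)) /\ x = \sum_i a i * g i.

Definition ideal_pow I (m : nat) : R -> Prop :=
  ideal_gen (fun x => exists g : 'I_m -> R,
    (forall i, I (g i)) /\ x = \prod_i g i).

Definition is_ideal I : Prop :=
  [/\ I 0, forall x y, I x -> I y -> I (x + y) & forall a x, I x -> I (a * x)].

Definition prime_ideal P : Prop :=
  [/\ is_ideal P, ~ P 1 & forall x y, P (x * y) -> P x \/ P y].

(* P is in Ass(R/I): P is prime and is the annihilator of the class of
   some x modulo I. *)
Definition associated_prime I P : Prop :=
  prime_ideal P /\ exists x, forall a, P a <-> I (a * x).

Definition regular_sequence (l : seq R) : Prop :=
  (forall i, (i < size l)%N -> forall y,
     ideal_gen (fun x => x \in take i l) (y * l`_i) ->
     ideal_gen (fun x => x \in take i l) y)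
  /\ ~ ideal_gen (fun x => x \in l) 1.

(* The classes modulo K of the elements of S lie in J/K and generate J/K
   as an R-module (for ideals K contained in J). *)
Definition generates_quotient J K S : Prop :=
  (forall x, S x -> J x) /\
  (forall x, J x -> exists2 y, ideal_gen S y & K (x - y)).

(* Minimality concerns S itself, so in addition distinct elements of S
   have distinct classes modulo K. *)
Definition minimal_generates_quotient J K S : Prop :=
  generates_quotient J K S /\
  (forall T, (forall x, T x -> S x) -> generates_quotient J K T ->
     forall x, S x -> T x).

End Ideals.

Section SymbolicPower.
Variable R : idomainType.
Implicit Types I P : R -> Prop.

(* The extension I R_P, with R_P viewed inside the fraction field of R. *)
Definition localized_ideal I P (z : {fraction R}) : Prop :=
  exists a b : R, [/\ I a, ~ P b & z = tofrac a / tofrac b].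

Definition symbolic_power I (m : nat) (x : R) : Prop :=
  forall P, associated_prime I P -> localized_ideal (ideal_pow I m) P (tofrac x).

End SymbolicPower.

Section StarConfiguration.
Variables (R : comNzRingType) (s : nat).

Definition any_regular (F : 'I_s -> R) (r : nat) : Prop :=
  forall j : seq 'I_s, uniq j -> size j = r -> regular_sequence (map F j).

Definition star_ideal (c : nat) (F : 'I_s -> R) (x : R) : Prop :=
  forall A : {set 'I_s}, #|A| = c ->
    ideal_gen (fun y => exists2 i, i \in A & y = F i) x.

End StarConfiguration.

(* A monomial in F_1, ..., F_s is given by its exponent vector e; the ring
   element that it denotes is [mmap1 F e = \prod_i F i ^+ e i]. Subsets of
   {F_1, ..., F_s} are given by sets of indices. *)
Section Monomials.
Local Open Scope nat_scope.
Variable s : nat.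
Implicit Types (e : 'X_{1..s}) (A B : {set 'I_s}) (l : seq {set 'I_s}).

Definition squarefree_mnm A : 'X_{1..s} := [multinom nat_of_bool (i \in A) | i < s].

Definition mnm_supp e : {set 'I_s} := [set i | e i != 0].

(* l lists the supports of the factors M^(1), ..., M^(t). *)
Definition is_normal_form e l : Prop :=
  [/\ e = (\sum_(A <- l) squarefree_mnm A)%MM,
      forall A, A \in l -> A != set0
    & sorted (fun A B => B \subset A) l].

Definition normal_form e : seq {set 'I_s} :=
  [seq [set i | j < e i] | j <- iota 0 (\max_i e i)].

Lemma normal_formP e l : is_normal_form e l <-> l = normal_form e.
Proof.
have tr : transitive (fun A B : {set 'I_s} => B \subset A).
  by move=> B A C sBA sCB; apply: subset_trans sCB sBA.
have cntE l' i : (\sum_(A <- l') squarefree_mnm A)%MM i = count (fun A => i \in A) l'.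
  elim: l' => [|A l' IH]; first by rewrite big_nil mnm0E.
  by rewrite big_cons mnmDE IH mnmE.
split=> [[eE l0 sl] | ->].
- have mem_lvl j i : j < size l -> (i \in nth set0 l j) = (j < e i).
    rewrite eE cntE => {eE l0 e}.
    elim: l sl j => [|A l IH] //= pl [|j] /= ltj.
      case iA: (i \in A) => //=; apply/esym/negbTE; rewrite -leqNgt leqn0.
      rewrite eqn0Ngt -has_count; apply/hasP => -[B Bl iB].
      have /allP/(_ _ Bl)/subsetP/(_ _ iB) := order_path_min tr pl.
      by rewrite iA.
    rewrite (IH (path_sorted pl)) //.
    case iA: (i \in A) => /=; first by rewrite add1n ltnS.
    suff -> : count (fun B => i \in B) l = 0 by rewrite ltn0.
    apply/eqP; rewrite eqn0Ngt -has_count; apply/hasP => -[B Bl iB].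
    have /allP/(_ _ Bl)/subsetP/(_ _ iB) := order_path_min tr pl.
    by rewrite iA.
  have szE : size l = \max_i e i.
    apply/eqP; rewrite eqn_leq; apply/andP; split; last first.
      by apply/bigmax_leqP => i _; rewrite eE cntE count_size.
    case sz: (size l) => [//|t].
    have ltt : t < size l by rewrite sz.
    have /set0Pn[i] := l0 _ (mem_nth set0 ltt).
    by rewrite mem_lvl // => /leq_trans; apply; apply: leq_bigmax.
  apply: (@eq_from_nth _ set0) => [|j ltj]; first by rewrite size_map size_iota.
  rewrite (nth_map 0) ?size_iota -?szE // nth_iota // add0n.
  by apply/setP => i; rewrite inE mem_lvl.
- split.
  + apply/mnmP => i; rewrite cntE count_map.
    rewrite (eq_count (a2 := fun j => j < e i)); last by move=> j /=; rewrite inE.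
    have /subnKC <- : e i <= \max_i e i by apply: leq_bigmax.
    rewrite iotaD count_cat -[LHS]addn0; congr (_ + _).
      rewrite -[LHS](size_iota 0); apply/esym/eqP; rewrite -all_count.
      by apply/allP => j; rewrite mem_iota.
    apply/esym/eqP; rewrite eqn0Ngt -has_count; apply/hasP => -[j].
    by rewrite mem_iota add0n => /andP[/leq_gtF ->].
  + move=> A /mapP[j]; rewrite mem_iota add0n => /andP[_ ltj] ->.
    apply/set0Pn; apply/existsP; apply: contraLR ltj => /existsPn nlt.
    by rewrite -leqNgt; apply/bigmax_leqP => i _; have := nlt i; rewrite inE -leqNgt.
  + rewrite sorted_map; apply: (sub_sorted _ (iota_sorted 0 _)) => j j' lejj' /=.
    by apply/subsetP => i; rewrite !inE; apply: leq_ltn_trans.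
Qed.

(* max{0, c - s + |A|} is the truncated difference c + |A| - s. *)
Definition Sdeg (c : nat) e : nat := \sum_(A <- normal_form e) (c + #|A| - s).

Definition Gset (c m : nat) e : Prop :=
  Sdeg c e = m /\ forall A, A \in normal_form e -> s + 1 - c <= #|A|.

Definition Gset' (c m : nat) e : Prop :=
  Gset c m e /\ s + 2 - c <= #|mnm_supp e|.

End Monomials.

(* Main.v *)
Require Import Defs.
From mathcomp Require Import all_boot all_order all_algebra.
From Stdlib Require Import Classical IndefiniteDescription.

Set Implicit Arguments.
Unset Strict Implicit.
Unset Printing Implicit Defensive.

Import Order.TTheory GRing.Theory.
Local Open Scope ring_scope.

(** Write [I] for the star ideal, [F^e] for the product of the [F i ^ e i],
[F_A] for the ideal of the [F i] with [i] in [A], and [w_A e] for the sum of the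
[e i] with [i] in [A], where [A] runs over the sets of [c] indices. The symbolic
degree of [e] is the least [w_A e], and the exponents in [Gset c m] are the
minimal ones among those with [w_A e >= m] for all [A] ([GsetP],
[extremal_below]).

The symbolic power [I^(m)] is generated by the [F^e] with [w_A e >= m] for all
[A]. Such an [F^e] is in it because an associated prime of [I] is one of some
[F_A] and contains none of the other [F i], and a power of their product
multiplies [F^e] into [I^m] ([associated_prime_avoids], [pow_star_monomial]).
Conversely let [x] in [I^(m)]
be a combination of the [F^e], [e] in [Gset c l], with [l < m]. Two such [e] of
weight [l] along the same [A] differ on [A] ([extremal_inj]), so the coefficient
of [F^e] is determined modulo [F_A] by the leading form of [x] along [A]
([leading_coefficient]). An associated prime of [F_A] is one of [I], and some
element outside it multiplies [x] into [I^m]; the coefficient is therefore in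
[F_A] ([symbolic_coefficient]). This holds for every [A] with [w_A e = l], and
the intersection of these [F_A] is generated by the [F i] and the products of
[F i] which raise the order of [F^e] to [l + 1] ([star_intersection],
[raise_order]). Hence [x] is a combination of the [F^e], [e] in [Gset c (l + 1)],
and one goes on until [m].

An [e] of [Gset c m] outside [Gset' c m] is [m] times the indicator of a set of
[s + 1 - c] indices, so [F^e] is in [I^m]. For minimality, take [e] in
[Gset' c m] and [A] with [w_A e = m]. Along [A] the leading forms of the other
generators do not involve the monomial of [e], and a generator of [I^m] involves
it only with the coefficient of [F^e] multiplied by some [F i], [i] outside [A]
([pow_star_leading]). A relation would thus give that [1] is in the ideal of
[c + 1] of the [F i], contrary to their regularity.

Associated primes exist because polynomial rings are Noetherian, which is proved
here from Dickson's lemma ([noetherian_mpoly]). *)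

(** * Ideals, the Noetherian property and associated primes *)

Section IdealGen.
Variable R : comNzRingType.
Implicit Types (I J S T : R -> Prop) (x y : R).

Lemma ideal_gen_sub S x : S x -> ideal_gen S x.
Proof.
move=> Sx; exists 1%N, (fun=> 1), (fun=> x); split=> //.
by rewrite big_ord1 mul1r.
Qed.

Lemma ideal_gen_ideal S : is_ideal (ideal_gen S).
Proof.
split.
- by exists 0%N, (fun=> 0), (fun=> 0); split=> [[]//|]; rewrite big_ord0.
- move=> _ _ [m [a [g [Sg ->]]]] [p [b [h [Sh ->]]]].
  pose glue (f1 : 'I_m -> R) (f2 : 'I_p -> R) (i : 'I_(m + p)) :=
    match split i with inl j => f1 j | inr j => f2 j end.
  exists (m + p)%N, (glue a b), (glue g h); split.
    by move=> i; rewrite /glue; case: (split i).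
  by rewrite big_split_ord /=; congr (_ + _); apply: eq_bigr => i _;
    rewrite /glue ?(unsplitK (inl i)) ?(unsplitK (inr i)).
- move=> u _ [m [a [g [Sg ->]]]]; exists m, (fun i => u * a i), g; split=> //.
  by rewrite mulr_sumr; apply: eq_bigr => i _; rewrite mulrA.
Qed.

Lemma ideal0 I : is_ideal I -> I 0. Proof. by case. Qed.

Lemma idealD I x y : is_ideal I -> I x -> I y -> I (x + y).
Proof. by case=> _ D _; apply: D. Qed.

Lemma ideal_mull I a x : is_ideal I -> I x -> I (a * x).
Proof. by case=> _ _; apply. Qed.

Lemma ideal_mulr I a x : is_ideal I -> I x -> I (x * a).
Proof. by rewrite mulrC; apply: ideal_mull. Qed.

Lemma idealN I x : is_ideal I -> I x -> I (- x).
Proof. by move=> iI Ix; rewrite -mulN1r; apply: ideal_mull. Qed.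

Lemma idealB I x y : is_ideal I -> I x -> I y -> I (x - y).
Proof. by move=> iI Ix Iy; apply: idealD => //; apply: idealN. Qed.

Lemma ideal_sum I (T : Type) (r : seq T) (P : pred T) (f : T -> R) :
  is_ideal I -> (forall t, P t -> I (f t)) -> I (\sum_(t <- r | P t) f t).
Proof.
move=> iI If; apply: (big_ind I) => //; first exact: ideal0.
by move=> x y; apply: idealD.
Qed.

Lemma ideal_gen_min S J x :
  is_ideal J -> (forall y, S y -> J y) -> ideal_gen S x -> J x.
Proof.
move=> iJ sSJ [m [a [g [Sg ->]]]]; apply: ideal_sum => // i _.
by apply: ideal_mull => //; apply: sSJ.
Qed.

Lemma ideal_gen_mono S T x :
  (forall y, S y -> T y) -> ideal_gen S x -> ideal_gen T x.
Proof.
by move=> sST; apply: ideal_gen_min (ideal_gen_ideal T) _ => y /sST /ideal_gen_sub.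
Qed.

Lemma colon_ideal I y : is_ideal I -> is_ideal (fun a => I (a * y)).
Proof.
move=> iI; split=> [|a b Ia Ib|a b Ib].
- by rewrite mul0r; apply: ideal0.
- by rewrite mulrDl; apply: idealD.
- by rewrite -mulrA; apply: ideal_mull.
Qed.

Lemma ideal_add I J : is_ideal I -> is_ideal J ->
  is_ideal (fun x => exists2 y, I y & J (x - y)).
Proof.
move=> iI iJ; split=> [|x x' [y Iy Jy] [y' Iy' Jy']|a x [y Iy Jy]].
- by exists 0; rewrite ?subr0; apply: ideal0.
- exists (y + y'); first exact: idealD.
  by rewrite opprD addrACA; apply: idealD.
- exists (a * y); first exact: ideal_mull.
  by rewrite -mulrBr; apply: ideal_mull.
Qed.

Lemma ideal_gen_split S (f : R) x :
  ideal_gen (fun y => y = f \/ S y) x -> exists r, ideal_gen S (x - r * f).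
Proof.
move=> Sx.
have iS := ideal_gen_ideal S.
apply: (ideal_gen_min (J := fun x => exists r, ideal_gen S (x - r * f))) Sx.
  split=> [|y z [r yr] [t zt]|a y [r yr]].
  - by exists 0; rewrite mul0r subr0; apply: ideal0.
  - by exists (r + t); rewrite mulrDl opprD addrACA; apply: idealD.
  - by exists (a * r); rewrite -mulrA -mulrBr; apply: ideal_mull.
move=> z [->|Sz].
  by exists 1; rewrite mul1r subrr; apply: ideal0.
by exists 0; rewrite mul0r subr0; apply: ideal_gen_sub.
Qed.

Lemma ideal_powM I m x y : ideal_pow I m x -> I y -> ideal_pow I m.+1 (x * y).
Proof.
move=> Ix Iy; apply: (ideal_gen_min (J := fun x => ideal_pow I m.+1 (x * y))) Ix.
  by apply: colon_ideal; apply: ideal_gen_ideal.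
move=> _ [g [Ig ->]]; apply: ideal_gen_sub.
exists (fun i => if unlift ord_max i is Some j then g j else y); split.
  by move=> i; case: unliftP.
rewrite big_ord_recr /= unlift_none; congr (_ * _); apply: eq_bigr => i _.
suff -> : widen_ord (leqnSn m) i = lift ord_max i by rewrite liftK.
by apply: val_inj; rewrite /= /bump leqNgt ltn_ord add0n.
Qed.

End IdealGen.

Section Noetherian.

(** One step that is not strict is enough to exclude strictly increasing chains. *)
Definition noetherian (R : comNzRingType) :=
  forall I : nat -> R -> Prop, (forall j, is_ideal (I j)) ->
    (forall j x, I j x -> I j.+1 x) -> exists j, forall x, I j.+1 x -> I j x.

Lemma nat_min_above (a : nat -> nat) N :
  exists j, (N <= j)%N /\ forall i, (N <= i)%N -> (a j <= a i)%N.
Proof.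
suff minw w j : (a j < w)%N -> (N <= j)%N ->
    exists j, (N <= j)%N /\ forall i, (N <= i)%N -> (a j <= a i)%N.
  exact: (minw _ N (ltnSn _) (leqnn _)).
elim: w j => // w IHw l alw Nl.
have [[i [Ni ail]]|no] := classic (exists i, (N <= i)%N /\ (a i < a l)%N).
  by apply: (IHw i) => //; apply: leq_trans ail _; rewrite -ltnS.
exists l; split=> // i Ni; rewrite leqNgt; apply/negP => lti.
by case: no; exists i.
Qed.


(** The indices from which on no smaller value occurs are unbounded, since every
tail of the sequence has a least value; the subsequence runs through them. *)
Lemma nondecreasing_subsequence (a : nat -> nat) :
  exists g : nat -> nat, {homo g : i j / (i < j)%N} /\
    {homo a \o g : i j / (i <= j)%N}.
Proof.
have [phi phiP] := functional_choice _ (nat_min_above a).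
pose g := fix g k := if k is k'.+1 then phi (g k').+1 else phi 0%N.
have gmin k i : (g k <= i)%N -> (a (g k) <= a i)%N.
  case: k => [|k] gi; first by have [_] := phiP 0%N; apply.
  by have [gk] := phiP (g k).+1; apply; apply: leq_trans gk gi.
have gS k : (g k < g k.+1)%N by have [] := phiP (g k).+1.
have gmono : {homo g : i j / (i < j)%N}.
  by apply: homo_ltn gS => y x z; apply: ltn_trans.
exists g; split=> // i j; rewrite leq_eqVlt => /predU1P[->//|/gmono/ltnW/gmin].
by [].
Qed.

(** Subsequences are extracted coordinate by coordinate. *)
Lemma dickson n (f : nat -> 'X_{1..n}) :
  exists i j, (i < j)%N /\ (f i <= f j)%MM.
Proof.
suff [g [gmono gle]] : exists g : nat -> nat, {homo g : i j / (i < j)%N} /\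
    forall l, l \in enum 'I_n -> {homo (fun i => f (g i) l) : i j / (i <= j)%N}.
  exists (g 0%N), (g 1%N); split; first exact: gmono.
  by apply/mnm_lepP => l; apply: (gle l) => //; rewrite mem_enum.
elim: (enum 'I_n) => [|l s [g [gmono gle]]]; first by exists id; split.
have [h [hmono hle]] := nondecreasing_subsequence (fun i => f (g i) l).
exists (g \o h); split=> [i j /hmono/gmono //|l'].
rewrite inE => /predU1P[->|/gle le_l'] i j; first exact: hle.
move=> leij; apply: le_l'.
by move: leij; rewrite leq_eqVlt => /predU1P[->//|/hmono/ltnW].
Qed.

(** Hilbert's basis theorem, by leading monomials: were the chain of ideals
strictly increasing, an element of least leading monomial in each difference
[I (j+1) - I j] would give, by Dickson's lemma, a leading monomial divisible by
an earlier one, and one reduction step would contradict minimality. *)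
Lemma noetherian_mpoly (k : fieldType) n : noetherian {mpoly k[n]}.
Proof.
move=> I iI subI; apply: NNPP => noj.
have leI i j x : (i <= j)%N -> I i x -> I j x.
  by move=> /subnKC <-; elim: (j - i)%N => [|d IH]; rewrite ?addn0 // addnS => /IH/subI.
have minp j : exists p : {mpoly k[n]}, [/\ I j.+1 p, ~ I j p &
    forall q, I j.+1 q -> ~ I j q -> ~ (mlead q < mlead p)%O].
  have [p0 [Ip0 nIp0]] : exists p, I j.+1 p /\ ~ I j p.
    apply: NNPP => nop; apply: noj; exists j => x Ix; apply: NNPP => nIx.
    by apply: nop; exists x.
  move: Ip0 nIp0; move: {2}(mlead p0) (erefl (mlead p0)) => l.
  elim/(well_founded_ind (@ltom_wf n)): l p0 => l IH p pl Ip nIp.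
  have [[q [Iq nIq ltq]]|noq] :=
      classic (exists q, [/\ I j.+1 q, ~ I j q & (mlead q < mlead p)%O]).
    by apply: (IH (mlead q)) Iq nIq; rewrite // -pl.
  by exists p; split=> // q Iq nIq ltq; apply: noq; exists q.
have [p pP] := functional_choice _ minp.
have [i [j [ltij leij]]] := dickson (fun i => mlead (p i)).
have [Ipj nIpj min_pj] := pP j; have [Ipi nIpi _] := pP i.
have Ipi' : I j (p i) by apply: leI Ipi.
have pi0 : p i != 0 by apply: contra_notN nIpi => /eqP ->; apply: ideal0.
have pj0 : p j != 0 by apply: contra_notN nIpj => /eqP ->; apply: ideal0.
pose a := mleadc (p j) / mleadc (p i).
pose d := (mlead (p j) - mlead (p i))%MM.
pose t := a *: 'X_[d] * p i.
have ci : mleadc (p i) != 0 by rewrite mleadc_eq0.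
have cj : mleadc (p j) != 0 by rewrite mleadc_eq0.
have a0 : a != 0 by rewrite mulf_neq0 ?invr_eq0.
have X0 : a *: 'X_[d] != 0 :> {mpoly k[n]}.
  apply: contraNneq a0 => /(congr1 (mcoeff d)).
  by rewrite mcoeffZ mcoeffX eqxx mulr1 mcoeff0 => ->.
have leadt : mlead t = mlead (p j).
  by rewrite mleadM // mleadZ // mleadXm submK.
have leadct : t@_(mlead (p j)) = mleadc (p j).
  have {1}-> : mlead (p j) = (mlead (a *: 'X_[k, d]) + mlead (p i))%MM.
    by rewrite mleadZ // mleadXm submK.
  by rewrite mleadcM mleadZ // mcoeffZ mleadXm mcoeffX eqxx mulr1 divfK.
have It : I j t by apply: ideal_mull.
have Iq : I j.+1 (p j - t) by apply: idealB => //; apply: subI.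
have nIq : ~ I j (p j - t).
  by move=> Iq'; apply: nIpj; rewrite -(subrK t (p j)); apply: idealD.
apply: min_pj Iq nIq _.
have q0 : p j - t != 0 by apply: contra_notN nIpj; rewrite subr_eq0 => /eqP ->.
rewrite lt_neqAle; apply/andP; split.
  apply: contraNneq q0 => eql; rewrite -mleadc_eq0 eql mcoeffB leadct.
  by rewrite subrr.
by apply: le_trans (mleadB_le _ _) _; rewrite leadt joinxx.
Qed.

End Noetherian.

Section AssociatedPrimes.
Variable R : comNzRingType.
Hypothesis noethR : noetherian R.

(** Among the ideals [Q : z], [z] outside [Q], that contain [Q : y], one is
maximal, and a maximal one is prime. *)
Lemma exists_associated_prime (Q : R -> Prop) y : is_ideal Q -> ~ Q y ->
  exists P, associated_prime Q P /\ forall a, Q (a * y) -> P a.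
Proof.
move=> iQ nQy.
pose good z := ~ Q z /\ forall a, Q (a * y) -> Q (a * z).
have [z [[nQz yz] zmax]] : exists z, good z /\
    forall z', good z' -> (forall a, Q (a * z) -> Q (a * z')) ->
      forall a, Q (a * z') -> Q (a * z).
  apply: NNPP => nomax.
  have bigger (z : {z | good z}) : exists z' : {z | good z},
      (forall a, Q (a * sval z) -> Q (a * sval z')) /\
      ~ (forall a, Q (a * sval z') -> Q (a * sval z)).
    apply: NNPP => noz'; apply: nomax; exists (sval z); split; first exact: svalP.
    move=> z' gz' zz'; apply: NNPP => nz'z; apply: noz'.
    by exists (exist _ z' gz').
  have [next nextP] := functional_choice _ bigger.
  have gy : good y by [].
  pose u j := iter j next (exist _ y gy).
  have [j uj] : exists j, forall a, Q (a * sval (u j.+1)) -> Q (a * sval (u j)).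
    apply: (noethR (I := fun j a => Q (a * sval (u j)))).
      by move=> j; apply: colon_ideal.
    by move=> j a; have [uS _] := nextP (u j); apply: uS.
  by have [_] := nextP (u j).
exists (fun a => Q (a * z)); split=> //; split; last by exists z.
split; first exact: colon_ideal.
  by rewrite mul1r.
move=> a b Qabz; apply: NNPP => nab.
have nQbz : ~ Q (b * z) by move=> Qbz; apply: nab; right.
apply: nab; left; apply: (zmax (b * z)); last by rewrite mulrA.
  split=> // a' /yz Qa'z; rewrite mulrCA; exact: ideal_mull.
by move=> a' Qa'z; rewrite mulrCA; apply: ideal_mull.
Qed.

End AssociatedPrimes.

(** * Monomials in a regular family *)

Section Monomials.
Variables (R : comNzRingType) (s : nat) (F : 'I_s -> R).
Implicit Types (A B C D Z : {set 'I_s}) (a : 'I_s -> nat) (x y : R).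
Implicit Types (e f : 'X_{1..s}).

Lemma mmap1D e f : mmap1 F (e + f)%MM = mmap1 F e * mmap1 F f.
Proof.
by rewrite /mmap1 -big_split /=; apply: eq_bigr => i _; rewrite mnmDE exprD.
Qed.

Lemma mmap1_le e f : (e <= f)%MM -> mmap1 F f = mmap1 F (f - e)%MM * mmap1 F e.
Proof. by move=> le_ef; rewrite -mmap1D submK. Qed.

Lemma mmap1_squarefree D : mmap1 F (squarefree_mnm D) = \prod_(i in D) F i.
Proof.
rewrite /mmap1 [RHS]big_mkcond /=; apply: eq_bigr => i _.
by rewrite mnmE; case: (i \in D).
Qed.

Definition var_ideal Z := ideal_gen (fun y => exists2 i, i \in Z & y = F i).

Definition power_ideal Z a :=
  ideal_gen (fun y => exists2 i, i \in Z & y = F i ^+ (a i).+1).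

Lemma var_ideal_ideal Z : is_ideal (var_ideal Z).
Proof. exact: ideal_gen_ideal. Qed.

Lemma power_ideal_ideal Z a : is_ideal (power_ideal Z a).
Proof. exact: ideal_gen_ideal. Qed.

Lemma var_idealS Z Z' x : Z \subset Z' -> var_ideal Z x -> var_ideal Z' x.
Proof.
by move=> /subsetP sZ; apply: ideal_gen_mono => _ [i /sZ Zi ->]; exists i.
Qed.

Lemma var_ideal_prod Z D i : i \in Z -> i \in D -> var_ideal Z (\prod_(j in D) F j).
Proof.
move=> Zi Di; rewrite (bigD1 i) //=; apply: (ideal_mulr _ (var_ideal_ideal Z)).
by apply: ideal_gen_sub; exists i.
Qed.

Lemma power_ideal_gen Z a i (r : R) (e : nat) : i \in Z -> (a i < e)%N ->
  power_ideal Z a (r * F i ^+ e).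
Proof.
move=> Zi /subnK <-; rewrite exprD mulrA; apply: (ideal_mull _ (power_ideal_ideal Z a)).
by apply: ideal_gen_sub; exists i.
Qed.

Lemma power_ideal_mono Z Z' a a' x :
  (forall i, i \in Z -> i \in Z' /\ (a' i <= a i)%N) ->
  power_ideal Z a x -> power_ideal Z' a' x.
Proof.
move=> le_a; apply: ideal_gen_min (power_ideal_ideal _ _) _.
move=> _ [i /le_a[Zi lei] ->]; rewrite -[X in power_ideal _ _ X]mul1r.
exact: power_ideal_gen.
Qed.

Lemma power_ideal_monomial Z e f : (exists2 i, i \in Z & (e i < f i)%N) ->
  power_ideal Z e (mmap1 F f).
Proof.
move=> [i Zi lti]; rewrite /mmap1 (bigD1 i) //= mulrC.
exact: power_ideal_gen.
Qed.

Lemma power_ideal_split Z a j x : j \in Z -> power_ideal Z a x ->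
  exists r, power_ideal (Z :\ j) a (x - r * F j ^+ (a j).+1).
Proof.
move=> Zj Zx; apply: ideal_gen_split; move: Zx; apply: ideal_gen_mono.
move=> _ [i Zi ->]; have [->|ij] := eqVneq i j; first by left.
by right; exists i; rewrite // !inE ij.
Qed.

Variable c : nat.

(** The form in which the regularity of any [c + 1] of the [F i], in any order,
enters the proofs. *)
Hypothesis regF : forall Z i y, (#|Z| <= c)%N -> i \notin Z ->
  var_ideal Z (y * F i) -> var_ideal Z y.

Definition lower a j : 'I_s -> nat := fun l => if l == j then (a l).-1 else a l.

Lemma lower_le a j l : (lower a j l <= a l)%N.
Proof. by rewrite /lower; case: eqP => // _; apply: leq_pred. Qed.

Lemma lower_sum Z a j : j \in Z -> (0 < a j)%N ->
  (\sum_(l in Z) lower a j l < \sum_(l in Z) a l)%N.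
Proof.
move=> Zj aj; rewrite (bigD1 j) //= [X in (_ < X)%N](bigD1 j) //=.
rewrite /lower eqxx -addSn prednK // leq_add2l.
by apply: leq_sum => l /andP[_ /negbTE ->].
Qed.

Lemma lower_power_ideal Z a j r : (0 < a j)%N ->
  power_ideal Z (lower a j) r -> power_ideal Z a (r * F j).
Proof.
move=> aj; apply: (ideal_gen_min (J := fun r => power_ideal Z a (r * F j))).
  exact/colon_ideal/power_ideal_ideal.
move=> _ [i Zi ->]; have [ij|ij] := eqVneq i j.
  rewrite ij -exprSr /lower eqxx prednK // -[_ ^+ _]mul1r.
  by apply: power_ideal_gen; rewrite -?ij.
by rewrite mulrC /lower (negbTE ij); apply: power_ideal_gen.
Qed.

(** A power [F j ^ (a+1)] with [a > 0] is divided out in two stages, first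
modulo [F j] and then modulo [F j ^ a], so that by induction the regularity
passes from the forms to their powers. *)
Lemma power_ideal_regular Z a i y : (#|Z| <= c)%N -> i \notin Z ->
  power_ideal Z a (y * F i) -> power_ideal Z a y.
Proof.
have [w] := ubnP (\sum_(j in Z) (a j).+1).
elim: w Z a i y => // w IH Z a i y; rewrite ltnS => ltw Zc nZi Zy.
have [j /andP[/= Zj aj]|a0] := pickP [pred j in Z | 0 < a j]%N; last first.
  have sub1 := @power_ideal_mono Z Z a (fun=> 0%N).
  have sub2 := @power_ideal_mono Z Z (fun=> 0%N) a.
  apply: sub2; last apply: (regF Zc nZi); last by apply: sub1 Zy.
  by move=> l Zl; split=> //; move: (a0 l); rewrite /= Zl lt0n; case: (a l).
have iP := power_ideal_ideal.
have cZ' : (#|Z :\ j| <= c)%N.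
  by apply: leq_trans (subset_leq_card (subD1set _ _)) Zc.
have sumD1 : (\sum_(l in Z) (a l).+1 = (a j).+1 + \sum_(l in Z :\ j) (a l).+1)%N.
  rewrite (bigD1 j) //=; congr (_ + _)%N; apply: eq_bigl => l.
  by rewrite !inE andbC.
pose a0 l := if l == j then 0%N else a l.
have Z0y : power_ideal Z a0 y.
  apply: (IH Z a0 i) => //.
    apply: leq_trans ltw; rewrite sumD1 (bigD1 j) //= /a0 eqxx.
    rewrite -addSn leq_add // (eq_bigl (fun l => l \in Z :\ j)).
      by apply: leq_sum => l; rewrite !inE => /andP[/negbTE -> _].
    by move=> l; rewrite !inE andbC.
  by apply: power_ideal_mono Zy => l Zl; split=> //; rewrite /a0; case: ifP.
have [r] := power_ideal_split Zj Z0y; rewrite /a0 eqxx expr1 => yr.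
have {}yr : power_ideal (Z :\ j) a (y - r * F j).
  apply: power_ideal_mono yr => l Zl; split=> //.
  by move: Zl; rewrite !inE => /andP[/negbTE -> _].
have yrZ : power_ideal Z a (y - r * F j).
  by apply: power_ideal_mono yr => l; rewrite !inE => /andP[].
have rij : power_ideal Z a (r * F j * F i).
  rewrite -[r * F j](subKr y) mulrBl.
  by apply: idealB => //; apply: ideal_mulr.
have [t] := power_ideal_split Zj rij.
rewrite mulrAC exprS [t * _]mulrCA [F j * _]mulrC -mulrBl => rt.
have {}rt : power_ideal (Z :\ j) a (r * F i - t * F j ^+ a j).
  apply: (IH _ _ j) rt => //; last by rewrite !inE eqxx.
  by apply: leq_trans ltw; rewrite sumD1 addSn ltnS leq_addl.
have ri : power_ideal Z (lower a j) (r * F i).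
  rewrite -(subrK (t * F j ^+ a j) (r * F i)); apply: idealD => //.
    apply: power_ideal_mono rt => l; rewrite !inE => /andP[_ ->]; split=> //.
    exact: lower_le.
  by apply: power_ideal_gen => //; rewrite /lower eqxx ltn_predL.
have {}ri : power_ideal Z (lower a j) r.
  apply: (IH _ _ i) ri => //; apply: leq_trans ltw.
  have : (\sum_(l in Z) (lower a j l).+1 < \sum_(l in Z) (a l).+1)%N.
    rewrite sumD1 (bigD1 j) //= /lower eqxx prednK // addSn ltnS leq_add2l.
    rewrite (eq_bigl (fun l => l \in Z :\ j)); last first.
      by move=> l; rewrite !inE andbC.
    by apply: leq_sum => l; rewrite !inE => /andP[/negbTE -> _].
  by [].
rewrite -(subrK (r * F j) y); apply: idealD => //.
exact: lower_power_ideal.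
Qed.

(** The powers are lowered one step at a time, each time by the regularity of the
factor [F j] modulo the powers of the others. *)
Lemma power_ideal_colon Z a y : (#|Z| <= c)%N ->
  power_ideal Z a (y * \prod_(i in Z) F i ^+ a i) -> var_ideal Z y.
Proof.
have [w] := ubnP (\sum_(j in Z) a j).
elim: w a => // w IH a ltw Zc Zy.
have [j /andP[/= Zj aj]|a0] := pickP [pred j in Z | 0 < a j]%N; last first.
  have {}a0 l : l \in Z -> a l = 0%N.
    by move=> Zl; move: (a0 l); rewrite /= Zl lt0n; case: (a l).
  rewrite big1 ?mulr1 in Zy; last by move=> l /a0 ->.
  by apply: (power_ideal_mono (a' := fun=> 0%N)) Zy.
have prodE : \prod_(i in Z) F i ^+ a i = (\prod_(i in Z) F i ^+ lower a j i) * F j.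
  rewrite (bigD1 j) //= [in RHS](bigD1 j) //= /lower eqxx mulrAC -exprSr prednK //.
  by congr (_ * _); apply: eq_bigr => l /andP[_ /negbTE ->].
rewrite prodE mulrA in Zy; have [r] := power_ideal_split Zj Zy.
rewrite exprSr mulrA -mulrBl => yr.
apply: (IH (lower a j)) => //.
  by apply: leq_trans (lower_sum Zj aj) _; rewrite -ltnS.
have {}yr : power_ideal (Z :\ j) a
    (y * \prod_(i in Z) F i ^+ lower a j i - r * F j ^+ a j).
  apply: (power_ideal_regular _ _ yr); last by rewrite !inE eqxx.
  by apply: leq_trans (subset_leq_card (subD1set _ _)) Zc.
rewrite -(subrK (r * F j ^+ a j) (y * _)); apply: idealD.
- exact: power_ideal_ideal.
- apply: power_ideal_mono yr => l; rewrite !inE => /andP[_ ->]; split=> //.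
  exact: lower_le.
- by apply: power_ideal_gen => //; rewrite /lower eqxx ltn_predL.
Qed.

(** Every monomial that exceeds [e] somewhere in [A] is in the ideal of the powers
[F i ^ (e i + 1)], [i] in [A]. So the coefficient of [F^e] in a combination of such
monomials is determined modulo [var_ideal A]: this replaces the description of the
associated graded ring of [var_ideal A] as a polynomial ring. *)
Lemma leading_coefficient A e y : (#|A| <= c)%N ->
  power_ideal A e (y * mmap1 F e) -> var_ideal A y.
Proof.
move=> Ac; rewrite /mmap1 (bigID (fun i => i \in A)) /= mulrA => Ay.
apply: (@power_ideal_colon A e) => //; move: Ay.
set v := y * _; move: v => v; pose reg x := forall v, power_ideal A e (v * x) ->
  power_ideal A e v.
apply: (big_ind reg) => [u|u1 u2 r1 r2 u|i nAi u]; first by rewrite mulr1.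
  by rewrite mulrA => /r2 /r1.
elim: (e i) u => [|d IH] u; first by rewrite mulr1.
by rewrite exprSr mulrA => /(power_ideal_regular Ac nAi) /IH.
Qed.

Definition star_gens B C d y :=
  (exists2 i, i \in B & y = F i) \/
  (exists D, [/\ D \subset C, #|D| = d & y = \prod_(i in D) F i]).

(** Induction on [C]. For [i] in [C], the sets [A] that contain [i] show that [x] is
a multiple of [F i] up to the generators that avoid [i], which already have the
right number of factors; the index [i] moves to [B] for this. The sets that avoid
[i] then say, by regularity, that the cofactor of [F i] is in the ideal for [C]
without [i] and the same [c'], whose generators have one factor less. *)
Lemma star_intersection B C c' x :
  (#|B| + c' <= c)%N -> [disjoint B & C] ->
  (forall A, A \subset C -> #|A| = c' -> var_ideal (B :|: A) x) ->
  ideal_gen (star_gens B C (#|C|.+1 - c')) x.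
Proof.
have [w] := ubnP #|C|; elim: w B C c' x => // w IH B C c' x ltw Bc dBC Cx.
case: c' Bc Cx => [|c'] Bc Cx.
  have := Cx _ (sub0set _) (cards0 _); rewrite setU0.
  by apply: ideal_gen_mono => y By; left.
have [C0|[i Ci]] := set_0Vmem C.
  (* the truncated number of factors is 0: the ideal is the whole ring *)
  rewrite C0 cards0 -[x]mulr1; apply: ideal_mull; first exact: ideal_gen_ideal.
  apply: ideal_gen_sub; right; exists set0.
  by rewrite sub0set cards0 subSS sub0n big_set0.
pose C' := C :\ i.
have cC : #|C| = #|C'|.+1 by rewrite (cardsD1 i) Ci.
have C'C : C' \subset C by apply: subD1set.
have nBi : i \notin B by apply: contraTN Ci => Bi; rewrite (disjointFr dBC Bi).
have nC'i : i \notin C' by rewrite !inE eqxx.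
have ltC' : (#|C'| < w)%N by rewrite -ltnS -cC.
have dBC' : [disjoint B & C'] by apply: disjointWr dBC.
rewrite cC subSS; set T := ideal_gen _; have iT : is_ideal T by apply: ideal_gen_ideal.
have x1 : ideal_gen (star_gens (i |: B) C' (#|C'|.+1 - c')) x.
  apply: IH => //.
  - by rewrite cardsU1 nBi add1n addSnnS.
  - by rewrite -setI_eq0 setIUl setU_eq0 !setI_eq0 disjoints1 nC'i.
  - move=> A AC' cA; rewrite -setUA.
    have := Cx (i |: A); rewrite setUCA; apply.
      by rewrite subUset sub1set Ci (subset_trans AC').
    by rewrite cardsU1 cA (contra (subsetP AC' _)).
have [r xr] : exists r, ideal_gen (star_gens B C' (#|C'|.+1 - c')) (x - r * F i).
  apply: ideal_gen_split; apply: ideal_gen_mono x1 => y.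
  move=> [[l /setU1P[->|Bl] ->]|D]; first by left.
    by right; left; exists l.
  by right; right.
have xrT : T (x - r * F i).
  apply: ideal_gen_mono xr => y [By|[D [DC' cD yD]]]; first by left.
  by right; exists D; split=> //; apply: subset_trans C'C.
have rC' : ideal_gen (star_gens B C' (#|C'|.+1 - c'.+1)) r.
  apply: IH => // A AC' cA.
  apply: (regF (i := i)).
  - by apply: leq_trans Bc; rewrite -cA cardsU leq_subr.
  - by rewrite inE negb_or nBi (contra (subsetP AC' _)).
  rewrite -(subKr x (r * F i)); apply: idealB; first exact: var_ideal_ideal.
    by apply: Cx => //; apply: subset_trans C'C.
  apply: ideal_gen_min (var_ideal_ideal _) _ xr.
  move=> y [[l Bl ->]|[D [DC' cD ->]]].
    by apply: ideal_gen_sub; exists l; rewrite // inE Bl.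
  have /set0Pn[l /setIP[Dl Al]] : D :&: A != set0.
    apply/eqP => DA0; have lec' := subset_leq_card AC'; rewrite cA in lec'.
    have : (#|D :|: A| <= #|C'|)%N by rewrite subset_leq_card // subUset DC'.
    rewrite cardsU DA0 cards0 subn0 cD cA addnS subnK.
      by rewrite leqNgt leqnSn.
    exact: leq_trans (ltnW lec') (leqnSn _).
  by apply: (var_ideal_prod (i := l)); rewrite // inE Al orbT.
rewrite -(subrK (r * F i) x); apply: idealD => //.
apply: (ideal_gen_min (J := fun r => T (r * F i))) rC'.
  exact: colon_ideal.
move=> y [[l Bl ->]|[D [DC' cD ->]]].
  by apply: ideal_mulr => //; apply: ideal_gen_sub; left; exists l.
have [lec'|ltc'] := leqP c' #|C'|.
  apply: ideal_gen_sub; right; exists (i |: D); split.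
  - by rewrite subUset sub1set Ci (subset_trans DC').
  - by rewrite cardsU1 (contra (subsetP DC' _)) // add1n cD subSS subSn.
  - by rewrite big_setU1 ?(contra (subsetP DC' _)) // mulrC.
(* here c' exceeds the size of C, and again the ideal is the whole ring *)
apply: ideal_mull => //; rewrite -[F i]mulr1; apply: ideal_mull => //.
apply: ideal_gen_sub; right; exists set0.
by rewrite sub0set cards0 big_set0; split=> //; apply/eqP; rewrite eq_sym subn_eq0.
Qed.

End Monomials.

(** * Weights and symbolic degrees of exponents *)

Section Combinatorics.
Local Open Scope nat_scope.
Variable s : nat.
Implicit Types (A B C D : {set 'I_s}) (e f : 'X_{1..s}).

Lemma subset_of_card B k : k <= #|B| -> exists2 A : {set 'I_s}, A \subset B & #|A| = k.
Proof.
move=> lek; exists [set i in take k (enum B)].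
  by apply/subsetP => i; rewrite inE => /mem_take; rewrite mem_enum.
rewrite cardsE (card_uniqP (take_uniq _ (enum_uniq _))) size_take -cardE.
by case: ltngtP lek.
Qed.

Lemma card_meet A B : s < #|A| + #|B| -> exists i, i \in A /\ i \in B.
Proof.
move=> lts; suff /set0Pn[i /setIP[]] : A :&: B != set0 by exists i.
apply: contraTneq lts => AB0; rewrite -leqNgt.
have := max_card (mem (A :|: B)); rewrite card_ord cardsU AB0 cards0.
by rewrite subn0.
Qed.

Definition weight A e := \sum_(i in A) e i.

Lemma weightD A e f : weight A (e + f)%MM = weight A e + weight A f.
Proof. by rewrite /weight -big_split; apply: eq_bigr => i _; rewrite mnmDE. Qed.

Lemma weight_sum A I (r : seq I) (g : I -> 'X_{1..s}) :
  weight A (\sum_(t <- r) g t)%MM = \sum_(t <- r) weight A (g t).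
Proof.
elim: r => [|t r IH]; rewrite ?big_nil ?big_cons.
  by rewrite /weight big1 // => i _; rewrite mnm0E.
by rewrite weightD IH.
Qed.

Lemma weight_squarefree A D : weight A (squarefree_mnm D) = #|A :&: D|.
Proof.
rewrite /weight -sum1_card big_mkcond /= [RHS]big_mkcond /=.
by apply: eq_bigr => i _; rewrite mnmE inE; case: (i \in A); case: (i \in D).
Qed.

Lemma weightU A B e : [disjoint A & B] -> weight (A :|: B) e = weight A e + weight B e.
Proof.
by move=> dAB; rewrite /weight -bigU //=; apply: eq_bigl => l; rewrite !inE.
Qed.

Lemma leq_weight A e f : (forall i, i \in A -> e i <= f i) -> weight A e <= weight A f.
Proof. by move=> lef; apply: leq_sum. Qed.

Lemma weight_lt A e f : weight A e < weight A f ->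
  exists2 i, i \in A & e i < f i.
Proof.
move=> ltw; apply: NNPP => no; move: ltw; rewrite ltnNge leq_weight // => i Ai.
by rewrite leqNgt; apply/negP => lti; apply: no; exists i.
Qed.

Lemma weight_le A e f : weight A e <= weight A f ->
  (exists2 i, i \in A & e i < f i) \/
  (weight A f = weight A e /\ forall i, i \in A -> f i = e i).
Proof.
move=> lew; have [|no] := classic (exists2 i, i \in A & e i < f i); first by left.
have le_fe i : i \in A -> f i <= e i.
  by move=> Ai; rewrite leqNgt; apply/negP => lti; apply: no; exists i.
have ew : weight A f = weight A e by apply/eqP; rewrite eqn_leq lew leq_weight.
right; split=> // i Ai; apply/eqP; rewrite eqn_leq le_fe //=.
move: lew; rewrite /weight (bigD1 i) //= [X in (_ <= X)](bigD1 i) //=.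
move=> lew; rewrite -(leq_add2r (\sum_(l in A | l != i) f l)).
apply: leq_trans lew; rewrite leq_add2l; apply: leq_sum => l /andP[Al _].
exact: le_fe.
Qed.

Lemma weight_swap A i j e : i \notin A -> j \in A ->
  weight (i |: A :\ j) e + e j = weight A e + e i.
Proof.
move=> nAi Aj; rewrite /weight big_setU1 ?inE ?(negbTE nAi) ?andbF //=.
by rewrite [in RHS](big_setD1 j) //= addnC addnCA [RHS]addnC.
Qed.

Lemma card_swap A i j : i \notin A -> j \in A -> #|i |: A :\ j| = #|A|.
Proof.
by move=> nAi Aj; rewrite cardsU1 !inE (negbTE nAi) andbF [RHS](cardsD1 j) Aj.
Qed.

Definition level e j : {set 'I_s} := [set i | j < e i].

Lemma SdegE c e : Sdeg c e = \sum_(j < \max_i e i) (c + #|level e j| - s).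
Proof.
by rewrite /Sdeg /normal_form big_map -{1}[\max_i e i]subn0 big_mkord.
Qed.

Lemma weight_levels A e : weight A e = \sum_(j < \max_i e i) #|A :&: level e j|.
Proof.
transitivity (\sum_(i in A) \sum_(j < \max_i e i) (j < e i : nat)).
  apply: eq_bigr => i _; have le_ei : e i <= \max_i e i by apply: leq_bigmax.
  rewrite -big_mkcond /= -(big_ord_widen _ (fun=> 1) le_ei).
  by rewrite sum1_card card_ord.
rewrite exchange_big /=; apply: eq_bigr => j _.
rewrite -sum1_card big_mkcond /= [RHS]big_mkcond /=; apply: eq_bigr => i _.
by rewrite !inE; case: (i \in A); case: (j < e i).
Qed.

Lemma Sdeg_le_weight A e : Sdeg #|A| e <= weight A e.
Proof.
rewrite SdegE weight_levels; apply: leq_sum => j _.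
rewrite leq_subLR -cardsUI leq_add2r.
by have := max_card (mem (A :|: level e j)); rewrite card_ord.
Qed.


(** In a set [A] of least weight no exponent is larger than one outside, by
exchange. So each level set is disjoint from [A] or contains the complement of [A],
and in both cases [c + #|level e j| - s] is the size of its trace on [A]. *)
Lemma Sdeg_weight c e : c <= s ->
  exists2 A : {set 'I_s}, #|A| = c & weight A e = Sdeg c e.
Proof.
move=> lecs; have [A0 _ cA0] : exists2 A : {set 'I_s}, A \subset [set: 'I_s] & #|A| = c.
  by apply: subset_of_card; rewrite cardsT card_ord.
have cA0' : #|A0| == c by apply/eqP.
case: (arg_minnP (P := fun A => #|A| == c) (weight^~ e) cA0') => A /eqP cA Amin.
have exch i l : i \in A -> l \notin A -> e i <= e l.
  move=> Ai nAl; have := Amin (l |: A :\ i); rewrite card_swap // cA eqxx => /(_ isT).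
  by rewrite -(leq_add2r (e i)) weight_swap // leq_add2l.
exists A => //; rewrite SdegE weight_levels; apply: eq_bigr => j _.
have [[l nAl lj]|nol] := classic (exists2 l, l \notin A & l \notin level e j).
  have AL0 : A :&: level e j = set0.
    apply/setP => i; rewrite !inE; apply/negP => /andP[Ai].
    rewrite inE -leqNgt in lj.
    by rewrite ltnNge (leq_trans _ lj) // exch.
  apply/eqP; rewrite AL0 cards0 eq_sym subn_eq0 -cA -cardsUI AL0 cards0 addn0.
  by have := max_card (mem (A :|: level e j)); rewrite card_ord.
have ALT : A :|: level e j = setT.
  apply/setP => l; rewrite in_setT in_setU; apply: contra_notT nol.
  by rewrite negb_or => /andP[nAl nl]; exists l.
by rewrite -cA -cardsUI ALT cardsT card_ord addKn.
Qed.

(** The exponents of the monomials in the intersection of the [m]-th powers of all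
the ideals generated by [c] of the variables. *)
Definition fat c m e := forall A, #|A| = c -> m <= weight A e.

Definition topmost e i := [forall j, e j <= e i].

(** The description of [Gset] by weights instead of normal forms, see [GsetP]. *)
Definition extremal c m e :=
  [/\ fat c m e, exists2 A : {set 'I_s}, #|A| = c & weight A e = m
    & forall A, #|A| = c -> exists2 i, i \in A & topmost e i].

Lemma topmostP e i : reflect (forall j, e j <= e i) (topmost e i).
Proof. exact: forallP. Qed.

Variable c : nat.
Hypotheses (c_gt0 : 0 < c) (c_le : c <= s).

Lemma fatP m e : fat c m e <-> m <= Sdeg c e.
Proof.
split=> [fat_e|le_m A cA]; last first.
  by apply: leq_trans le_m _; rewrite -cA Sdeg_le_weight.
by have [A cA <-] := Sdeg_weight e c_le; apply: fat_e.
Qed.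

(** For [e] nonzero, the topmost indices form the smallest nonempty level set; and a
set of indices has at least [s + 1 - c] elements if and only if it meets all sets
of size [c]. *)
Lemma GsetP m e : Gset c m e <-> extremal c m e.
Proof.
split=> [[<- levels]|[fat_e [A cA wA] top]].
  split; [by apply/fatP | exact: Sdeg_weight | move=> A cA].
  have [i0 Ai0] : exists i, i \in A by apply/set0Pn; rewrite -card_gt0 cA.
  case maxE: (\max_i e i) => [|h].
    exists i0 => //; apply/topmostP => j.
    by apply: leq_trans (leq_bigmax j) _; rewrite maxE.
  have [i [Ai]] : exists i, i \in A /\ i \in level e h.
    apply: card_meet; rewrite cA.
    have : s + 1 - c <= #|level e h|.
      apply: levels; apply/mapP; exists h => //.
      by rewrite mem_iota add0n maxE ltnS leqnn.
    by rewrite leq_subLR addn1.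
  rewrite inE => lth; exists i => //; apply/topmostP => j.
  by apply: leq_trans (leq_bigmax j) _; rewrite maxE.
split.
  apply/eqP; rewrite eqn_leq; apply/andP; split; last by apply/fatP.
  by rewrite -wA -cA Sdeg_le_weight.
move=> _ /mapP[j + ->]; rewrite mem_iota add0n => /andP[_ ltj].
rewrite leqNgt; apply/negP => lt_level.
have [A' A'L cA'] : exists2 A' : {set 'I_s}, A' \subset ~: level e j & #|A'| = c.
  apply: subset_of_card; rewrite -(leq_add2l #|level e j|) cardsC card_ord.
  by move: lt_level; rewrite addn1 subSn // ltnS leq_subRL // addnC.
have [i /(subsetP A'L)] := top A' cA'; rewrite !inE -leqNgt => leij /topmostP topi.
move: ltj; rewrite ltnNge => /negP; apply; apply/bigmax_leqP => l _.
exact: leq_trans (topi l) leij.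
Qed.

(** Otherwise the exchange of a topmost index of [A] for [i] would give a set of
weight less than [m]. *)
Lemma topmost_off m e A i : extremal c m e -> #|A| = c -> weight A e = m ->
  i \notin A -> topmost e i.
Proof.
move=> [fat_e _ top] cA wA nAi; have [j Aj /topmostP topj] := top A cA.
apply/topmostP => l; apply: leq_trans (topj l) _.
have := fat_e (i |: A :\ j); rewrite card_swap // => /(_ cA).
by rewrite -(leq_add2r (e j)) weight_swap // wA leq_add2l.
Qed.

(** Off a set [A] of weight [m] every exponent is the largest one, which is
reached in [A]; so the exponents on [A] determine all the others. *)
Lemma extremal_inj m e f A : extremal c m e -> extremal c m f ->
  #|A| = c -> weight A e = m -> weight A f = m ->
  (forall i, i \in A -> e i = f i) -> e = f.
Proof.
move=> ext_e ext_f cA we wf ef; apply/mnmP => i.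
have [/ef //|nAi] := boolP (i \in A).
have half e' f' : extremal c m e' -> extremal c m f' -> weight A f' = m ->
    (forall i, i \in A -> e' i = f' i) -> e' i <= f' i.
  move=> [_ _ top] ext_f' wf' ef'; have [j Aj /topmostP topj] := top A cA.
  apply: leq_trans (topj i) _; rewrite (ef' j Aj).
  by have /topmostP := topmost_off ext_f' cA wf' nAi; apply.
by apply/eqP; rewrite eqn_leq !half // => l /ef.
Qed.

(** A minimal element [f] of [fat c m] is extremal: by minimality every index with a
positive exponent is in a set of weight [m]. For a topmost index and a set [A] of
size [c] without topmost indices, exchanging the topmost index for an element of [A]
would then give a weight less than [m]. *)
Lemma extremal_below m f : fat c m f -> exists2 e, extremal c m e & (e <= f)%MM.
Proof.
have [w] := ubnP (mdeg f); elim: w f => // w IH f; rewrite ltnS => ltw fat_f.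
have [[i fi fat_i]|stuck] := classic (exists2 i, 0 < f i & fat c m (f - U_(i))%MM).
  have lei : (U_(i) <= f)%MM by rewrite lep1mP -lt0n.
  have [|e ext_e lee] := IH (f - U_(i))%MM _ fat_i.
    by apply: leq_trans ltw; rewrite -[X in _ < mdeg X](submK lei) mdegD mdeg1 addn1.
  by exists e => //; apply: lepm_trans lee (lem_subr _ _).
have tight i : 0 < f i -> exists A, [/\ #|A| = c, weight A f = m & i \in A].
  move=> fi; apply: NNPP => noA; apply: stuck; exists i => // A cA.
  have lei : (U_(i) <= f)%MM by rewrite lep1mP -lt0n.
  have wE : weight A f = weight A (f - U_(i))%MM + (i \in A).
    rewrite -[in LHS](submK lei) weightD; congr (_ + _).
    have -> : U_(i)%MM = squarefree_mnm [set i] :> 'X_{1..s}.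
      by apply/mnmP => l; rewrite !mnmE inE eq_sym.
    rewrite weight_squarefree; case: (boolP (i \in A)) => Ai.
      by rewrite (setIidPr _) ?sub1set // cards1.
    by apply/eqP; rewrite cards_eq0 setIC setI_eq0 disjoints1.
  case: (boolP (i \in A)) (wE) => Ai; rewrite ?addn0 => {}wE.
    have : m != weight A f by apply/eqP => mE; apply: noA; exists A.
    by have := fat_f A cA; rewrite leq_eqVlt => /predU1P[->|]; rewrite ?eqxx // wE addn1.
  by rewrite -wE fat_f.
exists f; last exact: lepm_refl.
split=> //.
  have [[i fi]|f0] := classic (exists i, 0 < f i).
    by have [A [cA wA _]] := tight i fi; exists A.
  have [A _ cA] : exists2 A : {set 'I_s}, A \subset [set: 'I_s] & #|A| = c.
    by apply: subset_of_card; rewrite cardsT card_ord.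
  exists A => //; apply/eqP; rewrite eqn_leq fat_f // andbT /weight big1 //.
  by move=> i _; apply/eqP; apply: contra_notT f0; rewrite -lt0n => fi; exists i.
move=> A cA; apply: NNPP => no_top.
have [i0 Ai0] : exists i, i \in A by apply/set0Pn; rewrite -card_gt0 cA.
case: (@arg_maxnP _ i0 xpredT (fun i => f i) isT) => i _ maxi.
have topi : topmost f i by apply/topmostP => j; apply: maxi.
have nAi : i \notin A by apply/negP => Ai; apply: no_top; exists i.
have lti j : j \in A -> f j < f i.
  move=> Aj; rewrite ltnNge; apply/negP => leij; apply: no_top; exists j => //.
  by apply/topmostP => l; apply: leq_trans (maxi l isT) leij.
have [A' [cA' wA' A'i]] := tight i (leq_ltn_trans (leq0n _) (lti _ Ai0)).
have [j Aj nA'j] : exists2 j, j \in A & j \notin A'.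
  apply/subsetPn; apply: contra nAi => sAA'.
  by have /eqP -> : A == A' by rewrite eqEcard sAA' cA cA' leqnn.
have := fat_f (j |: A' :\ i); rewrite card_swap // => /(_ cA').
by rewrite -(leq_add2r (f i)) weight_swap // wA' leq_add2l leqNgt lti.
Qed.

(** All topmost exponents are equal, and a set of weight [m] contains [B], by
[topmost_off]; so all choices of topmost indices to complete [B] have the same
weight. These are the families of sets to which [star_intersection] applies. *)
Lemma tight_sets m e (B := [set i | ~~ topmost e i]) A : extremal c m e ->
  A \subset ~: B -> #|A| = c - #|B| -> #|B :|: A| = c /\ weight (B :|: A) e = m.
Proof.
move=> ext_e sAB cA; have [_ [A0 cA0 wA0] top] := ext_e.
have [i0 _ topi0] := top A0 cA0.
have sBA0 : B \subset A0.
  apply/subsetP => i; rewrite inE; apply: contraNT.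
  by move=> /(topmost_off ext_e cA0 wA0).
have disj A1 : A1 \subset ~: B -> [disjoint B & A1].
  by rewrite -disjoints_subset disjoint_sym.
have wBA A1 : A1 \subset ~: B -> weight (B :|: A1) e = weight B e + #|A1| * e i0.
  move=> sA1; rewrite weightU ?disj //; congr (_ + _).
  rewrite -sum_nat_const; apply: eq_bigr => i /(subsetP sA1).
  rewrite !inE negbK => /topmostP topi; apply/eqP.
  by rewrite eqn_leq topi andbT; move/topmostP: topi0.
have cBA A1 : A1 \subset ~: B -> #|B :|: A1| = #|B| + #|A1|.
  by move=> /disj; rewrite -setI_eq0 cardsU => /eqP ->; rewrite cards0 subn0.
have sD : A0 :\: B \subset ~: B by rewrite setDE subsetIr.
have cD : #|A0 :\: B| = c - #|B| by rewrite cardsD (setIidPr sBA0) cA0.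
have A0E : B :|: A0 :\: B = A0 by rewrite -[RHS](setID A0 B) (setIidPr sBA0).
split; first by rewrite cBA // cA -cD -cBA // A0E.
by rewrite wBA // cA -cD -wBA // A0E.
Qed.

Lemma fat_raise m e D : extremal c m e ->
  (forall A, #|A| = c -> weight A e = m -> exists2 i, i \in A & i \in D) ->
  fat c m.+1 (e + squarefree_mnm D)%MM.
Proof.
move=> [fat_e _ _] meetD A cA; rewrite weightD weight_squarefree.
have := fat_e A cA; rewrite leq_eqVlt => /predU1P[mE|ltm]; last first.
  by apply: leq_trans ltm (leq_addr _ _).
have [i Ai Di] := meetD A cA (esym mE).
by rewrite -mE -addn1 leq_add2l card_gt0; apply/set0Pn; exists i; rewrite inE Ai.
Qed.

(** The level sets are contained in the support and, for [e] in [Gset c m], have at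
least [s + 1 - c] elements; if the support has no more, they are all equal to it. *)
Lemma small_support_power m e : 0 < m -> Gset c m e -> #|mnm_supp e| < s + 2 - c ->
  exists2 D : {set 'I_s}, #|D| = s.+1 - c & e = (squarefree_mnm D *+ m)%MM.
Proof.
move=> m_gt0 [SdegE' levels] small; set h := \max_i e i.
have levelE j : j < h -> level e j = mnm_supp e /\ #|level e j| = s.+1 - c.
  move=> ltj; have sub : level e j \subset mnm_supp e.
    by apply/subsetP => i; rewrite !inE -lt0n; apply: leq_ltn_trans.
  have big : s.+1 - c <= #|level e j|.
    rewrite -addn1; apply: levels; apply/mapP; exists j => //.
    by rewrite mem_iota add0n ltj.
  have small' : #|mnm_supp e| <= s.+1 - c.
    by move: small; rewrite addn2 subSn ?ltnS // leqW.
  split; last by apply/eqP; rewrite eqn_leq big (leq_trans (subset_leq_card sub)).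
  by apply/eqP; rewrite eqEcard sub (leq_trans small').
have hm : h = m.
  rewrite -SdegE' SdegE -/h (eq_bigr (fun=> 1)) ?sum1_card ?card_ord //.
  move=> j _; have [_ ->] := levelE j (ltn_ord j).
  by rewrite subnKC ?subSnn // leqW.
exists (mnm_supp e).
  by have [|<- ->] := levelE 0; rewrite ?hm.
apply/mnmP => i; rewrite mulmnE mnmE inE.
have [->|ei] /= := eqVneq (e i) 0; first by rewrite mul0n.
have le_ei : e i <= h by apply: leq_bigmax.
rewrite mul1n -hm; apply/eqP; rewrite eqn_leq le_ei /=.
have [|LE _] := levelE h.-1; first by rewrite hm ltn_predL.
have : i \in level e h.-1 by rewrite LE ?inE // hm ltn_predL.
by rewrite inE hm prednK.
Qed.

(** The support meets [A] in two indices at least: a topmost one, whose exponent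
bounds [e i], and one more, which makes the bound strict. *)
Lemma Gset'_off_lt m e A i : Gset' c m e -> #|A| = c -> weight A e = m ->
  i \notin A -> e i < m.
Proof.
move=> [/GsetP ext_e supp_e] cA wA nAi; have [_ _ top] := ext_e.
have [j Aj /topmostP topj] := top A cA.
have [l [Al]] : exists l, l \in A /\ l \in mnm_supp e :\ j.
  apply: card_meet; rewrite cA.
  have : s + 1 - c <= #|mnm_supp e :\ j|.
    have : s + 2 - c <= 1 + #|mnm_supp e :\ j|.
      by apply: leq_trans supp_e _; rewrite (cardsD1 j) leq_add2r leq_b1.
    by rewrite !leq_subLR addnCA addn2 add1n addn1 ltnS.
  by rewrite leq_subLR addn1.
rewrite !inE => /andP[lj el]; rewrite -wA /weight (bigD1 j) //=.
apply: leq_ltn_trans (topj i) _; rewrite -[X in X < _]addn0 ltn_add2l.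
by rewrite (bigD1 l) ?Al //= addn_gt0 lt0n el.
Qed.

Section Products.
Variables (m : nat) (D : 'I_m -> {set 'I_s}).
Hypothesis cD : forall t, #|D t| = s.+1 - c.
Let f := (\sum_t squarefree_mnm (D t))%MM.

Let meet A t : #|A| = c -> 0 < #|A :&: D t|.
Proof.
move=> cA; have [|i [Ai Di]] := @card_meet A (D t).
  by rewrite cA cD subnKC // leqW.
by rewrite card_gt0; apply/set0Pn; exists i; rewrite inE Ai.
Qed.

Let weightE A : weight A f = \sum_t #|A :&: D t|.
Proof. by rewrite weight_sum; apply: eq_bigr => t _; rewrite weight_squarefree. Qed.

Lemma products_fat : fat c m f.
Proof.
move=> A cA; rewrite weightE -[X in X <= _]card_ord -sum1_card.
by apply: leq_sum => t _; apply: meet.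
Qed.

(** Every [D t] meets [A]; for the weight to be [m], it does so in one index only, and
then it contains the complement of [A], by cardinality. *)
Lemma products_tight A i : #|A| = c -> weight A f <= m -> i \notin A -> f i = m.
Proof.
move=> cA wA nAi; rewrite /f mnm_sumE -[RHS]card_ord -sum1_card.
apply: eq_bigr => t _; rewrite mnmE; case: (boolP (i \in D t)) => //= nDi.
suff lt : m < weight A f by rewrite ltnNge wA in lt.
rewrite weightE (bigD1 t) //= -[X in X < _]card_ord -sum1_card (bigD1 t) //=.
rewrite -addSn leq_add //; last by apply: leq_sum => t' _; apply: meet.
have sub : A :|: D t \subset [set~ i].
  apply/subsetP => l /setUP Al; rewrite !inE.
  by apply: contraNneq nAi => il; case: Al; rewrite il // (negbTE nDi).
have := cardsUI A (D t); rewrite cA cD subnKC ?leqW // => cUI.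
have := subset_leq_card sub; rewrite cardsC1 card_ord => leU.
have s_gt0 : 0 < s by apply: leq_trans c_gt0 c_le.
rewrite -(leq_add2l s.-1) addn2 prednK // -cUI leq_add2r //.
Qed.

End Products.

End Combinatorics.

(** * Symbolic powers of the star ideal *)

Lemma localizedP (R : idomainType) (J P : R -> Prop) x :
  is_ideal J -> is_ideal P ->
  localized_ideal J P (tofrac x) <-> exists2 b, ~ P b & J (b * x).
Proof.
move=> iJ iP; have nz b : ~ P b -> tofrac b != 0.
  by rewrite tofrac_eq0 => nPb; apply: contra_notN nPb => /eqP ->; apply: ideal0.
split=> [[a [b [Ja nPb xE]]]|[b nPb Jbx]].
  exists b => //; suff -> : b * x = a by [].
  by apply/eqP; rewrite -tofrac_eq tofracM xE mulrC divfK // nz.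
by exists (b * x), b; split=> //; rewrite tofracM mulrAC divff ?mul1r // nz.
Qed.

Section RegularForms.
Variables (R : comNzRingType) (s c : nat) (F : 'I_s -> R).
Hypotheses (c_lt : (c < s)%N) (hreg : any_regular F c.+1).

Lemma var_idealE (Z : {set 'I_s}) x :
  ideal_gen (fun y => y \in map F (enum Z)) x <-> var_ideal F Z x.
Proof.
split; apply: ideal_gen_mono => y.
  by case/mapP => i; rewrite mem_enum => Zi ->; exists i.
by case=> i Zi ->; apply: map_f; rewrite mem_enum.
Qed.

Lemma any_regular_nzd (Z : {set 'I_s}) i y : (#|Z| <= c)%N -> i \notin Z ->
  var_ideal F Z (y * F i) -> var_ideal F Z y.
Proof.
move=> Zc nZi Zy.
have cZi : #|~: (i |: Z)| = (s - #|Z|.+1)%N.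
  by rewrite cardsCs setCK cardsU1 nZi card_ord.
(* the sequence is completed to [c + 1] indices with arbitrary ones *)
have [Y YZ cY] : exists2 Y : {set 'I_s}, Y \subset ~: (i |: Z) & #|Y| = (c - #|Z|)%N.
  by apply: subset_of_card; rewrite cZi -subSS leq_sub2r.
pose j := enum Z ++ i :: enum Y.
have uj : uniq j.
  rewrite cat_uniq /= !enum_uniq mem_enum negb_or mem_enum nZi /= andbT.
  have nYi : i \notin Y by apply/negP => /(subsetP YZ); rewrite !inE eqxx.
  rewrite nYi andbT; apply/hasPn => l; rewrite !mem_enum => /(subsetP YZ).
  by rewrite !inE negb_or => /andP[].
have sj : size j = c.+1 by rewrite size_cat /= -!cardE cY addnS subnKC.
have [/(_ #|Z|) + _] := hreg uj sj; rewrite size_map sj ltnS => /(_ Zc y).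
rewrite -map_take take_size_cat -?cardE // map_cat nth_cat size_map -cardE ltnn.
by rewrite subnn /= => nzd; apply/var_idealE/nzd/var_idealE.
Qed.

Lemma any_regular_proper (Z : {set 'I_s}) : #|Z| = c.+1 -> ~ var_ideal F Z 1.
Proof.
move=> cZ /var_idealE; have [|_] := hreg (enum_uniq (mem Z)); first by rewrite -cardE.
by [].
Qed.

End RegularForms.

Section StarIdeal.
Variables (R : idomainType) (s c : nat) (F : 'I_s -> R).
Hypothesis noethR : noetherian R.
Hypotheses (c_gt0 : (0 < c)%N) (c_lt : (c < s)%N).
Hypothesis regF : forall (Z : {set 'I_s}) i y, (#|Z| <= c)%N -> i \notin Z ->
  var_ideal F Z (y * F i) -> var_ideal F Z y.
Hypothesis properF : forall Z : {set 'I_s}, #|Z| = c.+1 -> ~ var_ideal F Z 1.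
Implicit Types (A B C D Z : {set 'I_s}) (e f : 'X_{1..s}) (x y : R).

Let c_le : (c <= s)%N := ltnW c_lt.

Notation star := (star_ideal c F).
Notation "e ^[ G ]" := (mmap1 G e).

Definition mon_ideal (E : 'X_{1..s} -> Prop) :=
  ideal_gen (fun x => exists2 e, E e & x = e^[F]).

Lemma mon_ideal_ideal E : is_ideal (mon_ideal E).
Proof. exact: ideal_gen_ideal. Qed.

Lemma star_ideal_ideal : is_ideal star.
Proof.
have iA A : is_ideal (var_ideal F A) by apply: var_ideal_ideal.
split=> [A _|x y Ix Iy A cA|a x Ix A cA].
- exact: (ideal0 (iA A)).
- exact: (idealD (iA A) (Ix A cA) (Iy A cA)).
- exact: (ideal_mull a (iA A) (Ix A cA)).
Qed.

Lemma pow_ideal m : is_ideal (ideal_pow star m).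
Proof. exact: ideal_gen_ideal. Qed.

Lemma star_ideal_prod D : (s < c + #|D|)%N -> star (\prod_(i in D) F i).
Proof.
move=> ltD A cA; have [|i [Ai Di]] := @card_meet _ A D; first by rewrite cA.
exact: var_ideal_prod Ai Di.
Qed.

Lemma star_ideal_gen x :
  star x -> mon_ideal (fun e => exists2 D : {set 'I_s},
    #|D| = (s.+1 - c)%N & e = squarefree_mnm D) x.
Proof.
move=> Ix; have := @star_intersection _ _ F c regF set0 setT c x.
rewrite cards0 add0n cardsT card_ord -setI_eq0 set0I eqxx => /(_ (leqnn _) isT) gen.
apply: ideal_gen_mono (gen _) => [y|A _ cA]; last by rewrite set0U; apply: Ix.
case=> [[i]|[D [_ cD ->]]]; first by rewrite inE.
by exists (squarefree_mnm D); [exists D | rewrite mmap1_squarefree].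
Qed.

Definition product_of_gens m f := exists D : 'I_m -> {set 'I_s},
  (forall t, #|D t| = (s.+1 - c)%N) /\ f = (\sum_t squarefree_mnm (D t))%MM.

Lemma pow_star_gen m x : ideal_pow star m x -> mon_ideal (product_of_gens m) x.
Proof.
apply: ideal_gen_min; first exact: mon_ideal_ideal.
move=> _ [g [Ig ->]]; elim: m g Ig => [|m IH] g Ig.
  rewrite big_ord0; apply: ideal_gen_sub; exists 0%MM; last by rewrite mmap11.
  by exists (fun=> set0); rewrite big_ord0; split=> // -[].
have iE := mon_ideal_ideal (product_of_gens m.+1).
rewrite big_ord_recl mulrC.
have {}IH := IH (fun i => g (lift ord0 i)) (fun i => Ig _).
set y := (\prod_i _) in IH *; move: (g ord0) (Ig ord0) => x0 /star_ideal_gen Ix0.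
apply: (ideal_gen_min (J := fun y => mon_ideal (product_of_gens m.+1) (y * x0))) IH.
  exact: colon_ideal.
move=> _ [f [D [cD ->]] ->]; rewrite mulrC.
apply: (ideal_gen_min (J := fun x0 => mon_ideal (product_of_gens m.+1) (x0 * _))) Ix0.
  exact: colon_ideal.
move=> _ [_ [D0 cD0 ->] ->]; rewrite -mmap1D; apply: ideal_gen_sub.
eexists; last by [].
exists (fun t => if unlift ord0 t is Some t' then D t' else D0); split.
  by move=> t; case: unliftP.
rewrite big_ord_recl unlift_none; congr (_ + _)%MM.
by apply: eq_bigr => t _; rewrite liftK.
Qed.

Lemma pow_star1 x : ideal_pow star 0 x.
Proof.
rewrite -[x]mulr1; apply: ideal_mull; first exact: pow_ideal.
apply: ideal_gen_sub; exists (fun=> 0); rewrite big_ord0.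
by split=> // -[].
Qed.

Lemma pow_star_squarefree D m : #|D| = (s.+1 - c)%N ->
  ideal_pow star m (squarefree_mnm D *+ m)%MM^[F].
Proof.
move=> cD; elim: m => [|m IH]; first exact: pow_star1.
rewrite mulmSr mmap1D; apply: ideal_powM => //; rewrite mmap1_squarefree.
by apply: star_ideal_prod; rewrite cD subnKC // leqW.
Qed.

(** Each unit of weight along [A] comes from a factor [F i], [i] in [A], and
combines with a product of the [F j], [j] outside [A], to a generator of [star]. *)
Lemma pow_star_monomial A m e : #|A| = c -> (m <= weight A e)%N ->
  ideal_pow star m ((\prod_(i in ~: A) F i) ^+ m * e^[F]).
Proof.
move=> cA; elim: m e => [|m IH] e ltm; first exact: pow_star1.
have [i Ai ei] : exists2 i, i \in A & (0 < e i)%N.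
  apply: NNPP => no; move: ltm; rewrite /weight big1 // => i Ai.
  by apply/eqP; apply: contra_notT no; rewrite -lt0n => ei; exists i.
have lei : (U_(i) <= e)%MM by rewrite lep1mP -lt0n.
rewrite (mmap1_le F lei) mmap1U exprSr mulrACA.
apply: ideal_powM.
  apply: IH; rewrite -ltnS; apply: leq_trans ltm _.
  rewrite -[in X in (X <= _)%N](submK lei) weightD -addn1 leq_add2l.
  rewrite /weight (bigD1 i) //= mnm1E eqxx big1 // => l /andP[_ li].
  by rewrite mnm1E eq_sym (negbTE li).
have nAi : i \notin ~: A by rewrite inE Ai.
rewrite mulrC -big_setU1 //=; apply: star_ideal_prod.
by rewrite cardsU1 nAi cardsCs setCK card_ord cA addnCA subnKC.
Qed.

Lemma var_ideal_regular_prod A y : #|A| = c ->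
  var_ideal F A (y * \prod_(i in ~: A) F i) -> var_ideal F A y.
Proof.
move=> cA; pose reg x := forall y, var_ideal F A (y * x) -> var_ideal F A y.
apply: (big_ind reg) y => [y|x x' rx rx' y|i nAi y]; first by rewrite mulr1.
  by rewrite mulrA => /rx' /rx.
by apply: regF; rewrite ?cA //; rewrite inE in nAi.
Qed.

(** Multiplication by the product of the [F i], [i] outside [A], embeds the quotient
of [R] by [var_ideal F A] into the quotient by [star]. *)
Lemma associated_prime_star A P : #|A| = c ->
  associated_prime (var_ideal F A) P -> associated_prime star P.
Proof.
move=> cA [primeP [x xP]]; split=> //; exists (x * \prod_(i in ~: A) F i) => a.
rewrite mulrA; split=> [/xP Aax|/(_ A cA) /var_ideal_regular_prod /xP //].
  apply: (ideal_gen_min (J := fun z => star (z * \prod_(i in ~: A) F i))) Aax.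
    by apply: colon_ideal; apply: star_ideal_ideal.
  move=> _ [i Ai ->]; have nAi : i \notin ~: A by rewrite inE Ai.
  rewrite -big_setU1 //=; apply: star_ideal_prod.
  by rewrite cardsU1 nAi cardsCs setCK card_ord cA addnCA subnKC.
by apply.
Qed.

(** [P] is the annihilator of some [y] modulo [star]. Being prime, it contains one of
the finitely many annihilators of [y] modulo the [var_ideal F A], hence is equal to
it, and [F i] is a nonzerodivisor modulo [var_ideal F A] for [i] outside [A]. *)
Lemma associated_prime_avoids P : associated_prime star P ->
  exists2 A : {set 'I_s}, #|A| = c & forall i, i \notin A -> ~ P (F i).
Proof.
move=> [[iP nP1 primeP] [y yP]].
have [A cA AP] : exists2 A : {set 'I_s}, #|A| = c &
    forall a, var_ideal F A (a * y) -> P a.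
  apply: NNPP => noA.
  have avoid A : exists a, #|A| = c -> var_ideal F A (a * y) /\ ~ P a.
    apply: NNPP => noa; apply: noA; exists A => [|a Aay]; apply: NNPP => H; apply: noa.
      by exists 0.
    by exists a.
  have [g gP] := functional_choice _ avoid.
  have nPg : ~ P (\prod_(A : {set 'I_s} | #|A| == c) g A).
    apply: (big_ind (fun a => ~ P a)) => // [a b nPa nPb /primeP[]//|A /eqP cA].
    by have [] := gP A cA.
  apply/nPg/yP => A cA; rewrite (bigD1 A) ?cA //= mulrAC; apply: ideal_mulr.
    exact: var_ideal_ideal.
  by have [] := gP A cA.
exists A => // i nAi PFi; apply: nP1; apply: AP; rewrite mul1r.
by apply: (regF _ nAi); [rewrite cA | rewrite mulrC; exact: (proj1 (yP _) PFi A cA)].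
Qed.

Lemma fat_symbolic m e : fat c m e -> symbolic_power star m e^[F].
Proof.
move=> fat_e P assP; have [[iP nP1 primeP] _] := assP.
apply/localizedP => //; first exact: pow_ideal.
have [A cA avoid] := associated_prime_avoids assP.
exists ((\prod_(i in ~: A) F i) ^+ m); last exact: pow_star_monomial (fat_e A cA).
have mulP a b : ~ P a -> ~ P b -> ~ P (a * b) by move=> nPa nPb /primeP[].
have nPp : ~ P (\prod_(i in ~: A) F i).
  by apply: (big_ind (fun a => ~ P a)) => // i; rewrite inE => /avoid.
by elim: m {fat_e} => // m IH; rewrite exprS; apply: mulP.
Qed.

Lemma extremal_power_ideal m e f A : extremal c m e -> extremal c m f ->
  #|A| = c -> weight A e = m -> e <> f -> power_ideal F A e f^[F].
Proof.
move=> ext_e ext_f cA we nef; have [fat_f _ _] := ext_f.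
apply: power_ideal_monomial; have := fat_f A cA; rewrite -we.
case/weight_le => // -[wf eqf]; case: nef.
by apply: (extremal_inj ext_e ext_f cA we); [rewrite wf | move=> i /eqf].
Qed.

Lemma fat_mon_ideal m f r : fat c m f -> mon_ideal (extremal c m) (r * f^[F]).
Proof.
move=> /(extremal_below c_gt0 c_le)[e ext_e lef]; rewrite (mmap1_le F lef) mulrA.
apply: ideal_mull; first exact: mon_ideal_ideal.
by apply: ideal_gen_sub; exists e.
Qed.

(** Equal exponents are collected: a polynomial in [s] variables over [R] holds the
coefficients of distinct monomials. *)
Lemma mon_ideal_distinct E x : mon_ideal E x ->
  exists p : {mpoly R[s]}, (forall e, e \in msupp p -> E e) /\
    x = \sum_(e <- msupp p) p@_e * e^[F].
Proof.
suff : mon_ideal E x -> exists p : {mpoly R[s]},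
    (forall e, e \in msupp p -> E e) /\ x = p.@[F].
  by move=> h /h[p [pE ->]]; exists p; rewrite mevalE.
apply: (ideal_gen_min (J := fun x => exists p : {mpoly R[s]},
  (forall e, e \in msupp p -> E e) /\ x = p.@[F])) => [|_ [e Ee ->]]; last first.
  exists 'X_[e]; split=> [f|]; last by rewrite mevalX.
  by rewrite msuppX inE => /eqP ->.
split=> [|_ _ [p [pE ->]] [q [qE ->]]|a _ [p [pE ->]]].
- by exists 0; rewrite msupp0 raddf0; split.
- exists (p + q); rewrite raddfD; split=> // e /msuppD_le.
  by rewrite mem_cat => /orP[/pE|/qE].
- by exists (a *: p); rewrite mevalZ; split=> // e /msuppZ_le /pE.
Qed.

(** The sets of weight [m] consist of the indices [B] that are not topmost and of
any [c - #|B|] topmost ones. By [star_intersection], [r] is thus a combination of the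
[F i] with [i] in [B] and of products of [F i] over sets of [s + 1 - c] indices; all
these meet every set of weight [m], and so raise the order of [e]. *)
Lemma raise_order m e r : extremal c m e ->
  (forall A, #|A| = c -> weight A e = m -> var_ideal F A r) ->
  mon_ideal (extremal c m.+1) (r * e^[F]).
Proof.
move=> ext_e rA; pose B := [set i | ~~ topmost e i].
have [fat_e [A0 cA0 wA0] _] := ext_e.
have tightB A : #|A| = c -> weight A e = m -> B \subset A.
  move=> cA wA; apply/subsetP => i; rewrite inE; apply: contraNT.
  exact: topmost_off ext_e cA wA.
have Bc : (#|B| <= c)%N by rewrite -cA0 subset_leq_card // tightB.
have gen_r : ideal_gen (star_gens F B (~: B) (#|~: B|.+1 - (c - #|B|))) r.
  apply: (star_intersection regF); first by rewrite subnKC.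
    by rewrite -setI_eq0 setICr.
  by move=> A sAB cA; have [] := tight_sets ext_e sAB cA; apply: rA.
have cD : (#|~: B|.+1 - (c - #|B|) = s.+1 - c)%N.
  by rewrite subnBA // addSn addnC cardsC card_ord.
rewrite cD in gen_r; have iE := mon_ideal_ideal (extremal c m.+1).
apply: (ideal_gen_min (J := fun r => mon_ideal (extremal c m.+1) (r * e^[F]))) gen_r.
  exact: colon_ideal.
suff raise D : (forall A, #|A| = c -> weight A e = m -> exists2 i, i \in A & i \in D) ->
    mon_ideal (extremal c m.+1) (\prod_(i in D) F i * e^[F]).
  move=> _ [[i Bi ->]|[D [_ {}cD ->]]].
    have <- : \prod_(j in [set i]) F j = F i by rewrite big_set1.
    apply: raise => A cA wA.
    by exists i; rewrite ?inE // (subsetP (tightB A cA wA)).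
  apply: raise => A cA wA; have [|i [Ai Di]] := @card_meet _ A D; last by exists i.
  by rewrite cA cD subnKC // leqW.
move=> meetD; rewrite -mmap1_squarefree -mmap1D addmC -[mmap1 _ _]mul1r.
exact/fat_mon_ideal/fat_raise.
Qed.

(** Were the coefficient [r] of [e] outside [var_ideal F A], some associated prime
of this ideal would contain all [a] with [a * r] in it. It is also an associated
prime of [star], so an element [b] outside it multiplies [x] into the [m]-th power
of [star]. The monomials there have weight at least [m > l] along [A], and so
[b * r] is in [var_ideal F A]: a contradiction. *)
Lemma symbolic_coefficient l m x (p : {mpoly R[s]}) e A :
  (l < m)%N -> symbolic_power star m x ->
  (forall f, f \in msupp p -> extremal c l f) ->
  x = \sum_(f <- msupp p) p@_f * f^[F] ->
  e \in msupp p -> #|A| = c -> weight A e = l -> var_ideal F A p@_e.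
Proof.
move=> ltlm symx pE xE pe cA wA; apply: NNPP => nAe.
have [P [assA killP]] := exists_associated_prime noethR (var_ideal_ideal F A) nAe.
have [primeP _] := assA; have [iP _ _] := primeP.
have /localizedP[||b nPb powbx] := symx P (associated_prime_star cA assA) => //.
  exact: pow_ideal.
apply/nPb/killP; apply: (leading_coefficient regF (e := e)); first by rewrite cA.
have iAe := power_ideal_ideal F A e.
have -> : b * p@_e * e^[F] =
    b * x - b * \sum_(f <- msupp p | f != e) p@_f * f^[F].
  by rewrite xE (bigD1_seq e) ?msupp_uniq //= mulrDr addrK mulrA.
apply: idealB => //.
  apply: ideal_gen_min (pow_star_gen powbx) => // _ [f [D [cD fE]] ->].
  apply/power_ideal_monomial/weight_lt; rewrite wA; apply: leq_trans ltlm _.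
  by rewrite fE; apply: (products_fat c_le cD).
apply: ideal_mull => //; rewrite big_seq_cond; apply: ideal_sum => // f.
move=> /andP[pf fe]; apply: ideal_mull => //.
by apply: (extremal_power_ideal (pE e pe) (pE f pf)) => //; apply/eqP; rewrite eq_sym.
Qed.

Lemma symbolic_extremal m x : symbolic_power star m x -> mon_ideal (extremal c m) x.
Proof.
move=> symx; have : (m <= m)%N by [].
elim: {1 3}m => [|l IH] lelm.
  by rewrite -[x]mulr1 -(mmap11 F); apply: fat_mon_ideal.
have [p [pE xE]] := mon_ideal_distinct (IH (ltnW lelm)).
rewrite xE big_seq; apply: ideal_sum => [|e pe]; first exact: mon_ideal_ideal.
apply: raise_order; first exact: pE.
by move=> A cA wA; apply: (symbolic_coefficient lelm symx pE xE).
Qed.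

Let monomials m x := exists2 e, Gset' c m e & x = e^[F].

Lemma symbolic_generated m : (0 < m)%N ->
  generates_quotient (symbolic_power star m) (ideal_pow star m) (monomials m).
Proof.
move=> m_gt0; split=> [_ [e [/(GsetP c_gt0 c_le)[fat_e _ _] _] ->]|x].
  exact: fat_symbolic.
move=> /symbolic_extremal; apply: (ideal_gen_min
  (J := fun x => exists2 y, ideal_gen (monomials m) y & ideal_pow star m (x - y))).
  by apply: ideal_add; [apply: ideal_gen_ideal | apply: pow_ideal].
move=> _ [e /(GsetP c_gt0 c_le) Ge ->].
have [big_supp|small_supp] := leqP (s + 2 - c) #|mnm_supp e|.
  exists (e^[F]); last by rewrite subrr; apply: ideal0 (pow_ideal m).
  by apply: ideal_gen_sub; exists e.
exists 0; first exact: ideal0 (ideal_gen_ideal _).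
rewrite subr0; have [D cD ->] := small_support_power c_le m_gt0 Ge small_supp.
exact: pow_star_squarefree.
Qed.

(** A generator of the [m]-th power of [star] with exponent [f] either exceeds [e]
somewhere in [A], or agrees with [e] on [A]. In the second case [f] is [m] outside
[A], by [products_tight], where [e] is less than [m], so [f] is [e] times a monomial
that contains [F i]. *)
Lemma pow_star_leading m e A i z : Gset' c m e -> #|A| = c -> weight A e = m ->
  i \notin A -> ideal_pow star m z ->
  exists r, power_ideal F A e (z - r * (e^[F] * F i)).
Proof.
move=> Ge cA wA nAi powz; apply: ideal_gen_split.
apply: ideal_gen_min (ideal_gen_ideal _) _ (pow_star_gen powz).
move=> _ [f [D [cD fE]] ->].
have := products_fat c_le cD cA; rewrite -fE -wA => /weight_le[Af|[wf eqf]].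
  by apply: ideal_gen_mono (power_ideal_monomial F Af) => y Ay; right.
have off j : j \notin A -> f j = m.
  move=> nAj; rewrite fE.
  by apply: (products_tight c_gt0 c_le cD cA); rewrite -?fE ?wf ?wA.
have lef : (e + U_(i) <= f)%MM.
  apply/mnm_lepP => j; rewrite mnmDE mnm1E.
  have [Aj|nAj] := boolP (j \in A).
    by rewrite eqf //; case: eqVneq nAi => [->|]; rewrite ?Aj ?addn0.
  rewrite off //; have lt_m := Gset'_off_lt c_gt0 c_le Ge cA wA nAj.
  by case: eqP => _; rewrite ?addn0 ?addn1 // ltnW.
rewrite (mmap1_le F lef) mmap1D mmap1U; apply: ideal_mull.
  exact: ideal_gen_ideal.
by apply: ideal_gen_sub; left.
Qed.

(** If [T] missed [F^e], the congruence of [F^e] to an element of the ideal of [T]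
modulo the [m]-th power of [star] would read, in leading forms along a set [A] of
weight [m], as [1 - r * F i] in [var_ideal F A] with [i] outside [A]. *)
Lemma symbolic_minimal m (T : R -> Prop) : (forall x, T x -> monomials m x) ->
  generates_quotient (symbolic_power star m) (ideal_pow star m) T ->
  forall x, monomials m x -> T x.
Proof.
move=> subT [_ genT] x [e Ge xE]; apply: NNPP => nTx.
have [/(GsetP c_gt0 c_le) ext_e _] := Ge; have [fat_e [A cA wA] _] := ext_e.
have [i nAi] : exists i, i \notin A.
  have : (0 < #|~: A|)%N by rewrite cardsCs setCK card_ord cA subn_gt0.
  by rewrite card_gt0 => /set0Pn[i]; rewrite inE => nAi; exists i.
have iAe := power_ideal_ideal F A e.
have [y Ty powxy] := genT _ (fat_symbolic fat_e).
have Ay : power_ideal F A e y.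
  apply: ideal_gen_min Ty => // z Tz; have [f Gf zE] := subT z Tz; rewrite zE.
  have [/(GsetP c_gt0 c_le) ext_f _] := Gf.
  apply: (extremal_power_ideal ext_e ext_f cA wA) => ef.
  by apply: nTx; rewrite xE ef -zE.
have [r] := pow_star_leading Ge cA wA nAi powxy; rewrite addrAC => Axr.
have {Axr} Axr : power_ideal F A e ((1 - r * F i) * e^[F]).
  have -> : (1 - r * F i) * e^[F] = e^[F] - r * (e^[F] * F i) - y + y.
    by rewrite subrK mulrBl mul1r -mulrA [F i * _]mulrC.
  exact: idealD.
have {Axr} A1 : var_ideal F A (1 - r * F i).
  by apply: (leading_coefficient regF _ Axr); rewrite cA.
apply: (@properF (i |: A)); first by rewrite cardsU1 nAi cA.
rewrite -(subrK (r * F i) 1); apply: (idealD (var_ideal_ideal F _)).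
  by apply: var_idealS A1; apply: subsetUr.
apply: (ideal_mull _ (var_ideal_ideal F _)).
by apply: ideal_gen_sub; exists i; rewrite // setU11.
Qed.

End StarIdeal.

Theorem theorem4p11 (k : fieldType) (n c s : nat) (F : 'I_s -> {mpoly k[n.+1]})
    (hc : (1 <= c)%N) (hcs : (c < s)%N)
    (hinj : injective F)
    (hform : forall i, exists d : nat, F i \is d.-homog)
    (hreg : any_regular F c.+1)
    (m : nat) (hm : (1 <= m)%N) :
  minimal_generates_quotient
    (symbolic_power (star_ideal c F) m)
    (ideal_pow (star_ideal c F) m)
    (fun M : {mpoly k[n.+1]} => exists2 e : 'X_{1..s}, Gset' c m e & M = mmap1 F e).
Proof.
have noethR := @noetherian_mpoly k n.+1.
have regF := any_regular_nzd hcs hreg.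
have properF := any_regular_proper hreg.
split; first exact: symbolic_generated.
by move=> T; apply: symbolic_minimal.
Qed.
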